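(* Let $\mu$ be a Borel measure on $\mathbb{R}$, and let $m$ denote Lebesgue measure on $\mathbb{R}$. Then $\mu$ has the Steinhaus property if and only if $\mu$ is absolutely continuous with respect to $m$ (that is, $\mu(B)=0$ for every Borel set $B\subset\mathbb{R}$ with $m(B)=0$).
   Context: A Borel measure on $\mathbb{R}$ means a nonnegative measure on the Borel $\sigma$-algebra of $\mathbb{R}$ that is finite on compact sets. A set is called $\mu$-measurable if it belongs to the completion of the Borel $\sigma$-algebra with respect to $\mu$. For $A\subset\mathbb{R}$, the difference set is $A-A=\{a-b : a,b\in A\}$. A Borel measure $\mu$ on $\mathbb{R}$ has the Steinhaus property (SP) if for every $\mu$-measurable set $A$ with $\mu(A)>0$ the difference set $A-A$ contains an open interval around zero, i.e. there is $\varepsilon>0$ with $(-\varepsilon,\varepsilon)\subset A-A$. *)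

(* Defs.v *)
From mathcomp Require Import all_boot all_order all_algebra.
From mathcomp Require Import all_classical all_reals all_analysis measurable_realfun.

Set Implicit Arguments.
Unset Strict Implicit.
Unset Printing Implicit Defensive.
Import Order.TTheory GRing.Theory Num.Theory.
Import numFieldNormedType.Exports.

Local Open Scope classical_set_scope.
Local Open Scope ring_scope.

Section steinhaus.
Context {R : realType}.
Implicit Types (mu : {measure set (measurableTypeR R) -> \bar R}) (A : set R).

Definition finite_on_compacts mu : Prop :=
  forall K : set R, compact K -> (mu K < +oo)%E.

(* [completed_algebra_gen mu] is the set of all [B `|` N] with [B] Borel and
   [N] contained in a Borel mu-null set; it is already a sigma-algebra. *)
Definition completion_measurable mu A : Prop := completed_algebra_gen mu A.

(* The outer measure generated by [mu]; on the completed sigma-algebra it is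
   the completion of [mu], see [completed_measureU]. *)
Definition completed_measure mu : set R -> \bar R :=
  @completed_measure_extension _ _ _ mu.

Lemma completed_measureU mu (B N : set (measurableTypeR R)) :
  measurable B -> mu.-negligible N -> completed_measure mu (B `|` N) = mu B.
Proof.
move=> mB [M [mM M0 NM]]; rewrite /completed_measure/completed_measure_extension.
apply/eqP; rewrite eq_le; apply/andP; split.
  apply: (@le_trans _ _ (mu_ext mu (B `|` M))).
    by apply: le_mu_ext; exact: setUS.
  rewrite measurable_mu_extE; last exact: measurableU.
  by rewrite -[leRHS]adde0 -M0; exact: measureU2.
by rewrite -[leLHS]measurable_mu_extE//; apply: le_mu_ext; exact: subsetUl.
Qed.

Definition difference_set A : set R := [set a - b | a in A & b in A].

Definition steinhaus_property mu : Prop :=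
  forall A, completion_measurable mu A -> (0 < completed_measure mu A)%E ->
    exists2 e : R, 0 < e & `]- e, e[ `<=` difference_set A.

End steinhaus.

(* Main.v *)
From HB Require Import structures.
Require Import Defs.
From mathcomp Require Import all_boot all_order all_algebra.
From mathcomp Require Import all_classical all_reals all_analysis measurable_realfun.

(** Both implications compare a set [B] with its translates, a real [t] being
    a difference of two points of [B] exactly when [B] meets its preimage
    under translation by [t].

    If [mu] is absolutely continuous, a set of positive [mu]-measure contains
    a Borel set of positive Lebesgue measure, and the classical Steinhaus
    theorem ([positive_lebesgue_difference_set]) applies. For the latter, take
    a compact [K] of positive measure and an open [U] containing [K] with
    [U `\` K] smaller than [K]: by compactness, small translates of [K] stay
    in [U], and they are too large to fit in [U `\` K], so they meet [K].

    If [mu] is not absolutely continuous, let [B] be Lebesgue null with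
    [mu B > 0]. By Tonelli, the integral over [t] of
    [mu (B `&` (B - t))] is the integral over [x] in [B] of the Lebesgue
    measure of [B - x], hence zero. So almost every [t] has a [mu]-null
    overlap ([ae_null_overlap]), and there is a sequence [t n] of such numbers
    tending to zero. Deleting the countably many null overlaps from [B] leaves
    a set of the same positive [mu]-measure, none of whose differences is a
    [t n] ([lebesgue_null_small_difference_set]): its difference set contains
    no neighbourhood of zero. *)

Import Order.TTheory GRing.Theory Num.Theory.
Import numFieldNormedType.Exports.

Local Open Scope classical_set_scope.
Local Open Scope ring_scope.

Lemma measurable_preimage_addr (R : realType) (t : R)
    (A : set (measurableTypeR R)) :
  measurable A -> measurable ((+%R^~ t) @^-1` A : set (measurableTypeR R)).
Proof.
move=> mA; rewrite -[X in measurable X]setTI.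
by apply: (_ : measurable_fun setT (+%R^~ t : measurableTypeR R -> _)) => //;
  exact: measurable_funD.
Qed.

Lemma lebesgue_measure_preimage_addr (R : realType) (t : R)
    (A : set (measurableTypeR R)) :
  measurable A -> lebesgue_measure ((+%R^~ t) @^-1` A) = lebesgue_measure A.
Proof.
pose shift : measurableTypeR R -> measurableTypeR R := +%R^~ t.
have mshift : measurable_fun setT shift by exact: measurable_funD.
pose nu := pushforward (@lebesgue_measure R) shift.
(* [nu] is a measure because [shift] is measurable; it agrees with Lebesgue
   measure on bounded half-open intervals, which determine the latter. *)
move=> mA; apply/esym/(@lebesgue_measure_unique R nu) => // _ [ab _ <-].
transitivity (lebesgue_measure `]ab.1 - t, ab.2 - t]%classic).
  by rewrite !lebesgue_measure_itv/= !lte_fin ltrD2r -!EFinB opprB addrA subrK.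
congr (lebesgue_measure _).
by apply/seteqP; split=> x /=; rewrite !in_itv/= ltrBlDr lerBrDr.
Qed.

(** Continuity of subtraction gives this near each point of [K]; compactness
    makes the neighbourhood of zero uniform. *)
Lemma compact_shift_sub (R : realType) (K U : set R) :
  compact K -> open U -> K `<=` U ->
  \forall t \near (0 : R), forall x, K x -> U (x - t).
Proof.
move=> /compact_near_coveringP cK oU KU.
apply: (cK _ (nbhs (0 : R)) (fun t x => U (x - t))) => x Kx.
have : (fun z : R * R => z.1 - z.2) @ (x, 0 : R) --> x - 0.
  by apply: cvgB; [exact: cvg_fst|exact: cvg_snd].
rewrite subr0; apply; apply: open_nbhs_nbhs; split => //; exact: KU.
Qed.

Lemma finite_on_compacts_sigma_finite (R : realType)
    (mu : {measure set (measurableTypeR R) -> \bar R}) :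
  finite_on_compacts mu -> sigma_finite setT mu.
Proof.
move=> mu_fin; exists (fun k => `[- k%:R, k%:R]%classic); first by rewrite bigcup_itvT.
move=> k; split; first exact: measurable_itv.
by apply: mu_fin; exact: segment_compact.
Qed.

(** Nonempty open intervals are not Lebesgue null. *)
Lemma ae_pos_small (R : realType) (P : R -> Prop) (e : R) : 0 < e ->
  {ae @lebesgue_measure R, forall t, P t} -> exists t, [/\ 0 < t, t < e & P t].
Proof.
move=> e0 [N [mN N0 PN]]; apply: contrapT => noP.
have : (@lebesgue_measure R `]0%R, e[%classic <= lebesgue_measure N)%E.
  apply: le_measure; rewrite ?inE//.
  move=> t /=; rewrite in_itv/= => /andP[t0 te].
  by apply: PN => /= Pt; apply: noP; exists t.
by rewrite N0 lebesgue_measure_itv/= lte_fin e0 -EFinD subr0 lee_fin leNgt e0.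
Qed.

(** Tonelli for the set [G] of pairs [(t, x)] with both [x] and [x + t] in
    [B]: its sections at fixed [x] lie in a translate of [B], so they are
    Lebesgue null, and its sections at fixed [t] are the overlaps. *)
Lemma ae_null_overlap (R : realType)
    (mu : {sigma_finite_measure set (measurableTypeR R) -> \bar R})
    (B : set (measurableTypeR R)) :
  measurable B -> lebesgue_measure B = 0%E ->
  {ae @lebesgue_measure R, forall t, mu (B `&` (+%R^~ t) @^-1` B) = 0%E}.
Proof.
move=> mB B0.
pose G : set (measurableTypeR R * measurableTypeR R) :=
  [set z | B z.2 /\ B (z.2 + z.1)].
have mG : measurable G.
  apply: measurableI.
    by rewrite -[X in measurable X]setTI; exact: measurable_snd.
  rewrite -[X in measurable X]setTI.
  apply: (_ : measurable_fun setT
    (fun z : measurableTypeR R * measurableTypeR R => (z.2 + z.1) : measurableTypeR R)) => //.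
  by apply: measurable_funD; [exact: measurable_snd|exact: measurable_fst].
have GE t : xsection G t = B `&` (+%R^~ t) @^-1` B.
  by apply/seteqP; split=> x; rewrite /xsection/= inE.
have : (lebesgue_measure \x mu)%E G = 0%E.
  rewrite (product_measure_unique (m' := [the measure _ _ of (lebesgue_measure \x^ mu)%E])) //.
    apply: integral0_eq => x _ /=.
    apply: (subset_measure0 (mu := lebesgue_measure)
      (B := (+%R^~ x) @^-1` B : set (measurableTypeR R))).
    - exact: measurable_ysection.
    - exact: measurable_preimage_addr.
    - by move=> t; rewrite /ysection/= inE => -[_] /=; rewrite addrC.
    - exact: etrans (lebesgue_measure_preimage_addr _ x _ mB) B0.
  by move=> A1 A2 mA1 mA2; rewrite /= product_measure2E.
rewrite /product_measure1 => int0.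
have [|N [mN N0 subN]] := (ae_eq_integral_abs lebesgue_measure measurableT
  (measurable_fun_xsection mu mG)).1.
  by under eq_integral do rewrite gee0_abs//.
exists N; split => // t /= ht; apply: subN => /= /(_ I).
by rewrite GE.
Qed.

(** The classical Steinhaus theorem: by regularity the set
    contains a compact [K] filling more than half of an open neighbourhood [U]
    of [K], which leaves no room for two disjoint translates of [K] in [U]. *)
Lemma positive_lebesgue_difference_set (R : realType) (B : set (measurableTypeR R)) :
  measurable B -> (0 < lebesgue_measure B)%E ->
  exists2 e : R, 0 < e & `]- e, e[ `<=` difference_set B.
Proof.
move=> mB; rewrite (lebesgue_regularity_inner_sup mB) => /ereal_sup_gt.
move=> [_ [K [cK KB] <-] K_gt0].
have mK := compact_measurable cK.
have K_fin := compact_finite_measure cK.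
have mK_fin : lebesgue_measure K \is a fin_num by rewrite ge0_fin_numE.
have [|U [oU KU UK]] := lebesgue_regularity_outer mK K_fin
    (eps := fine (lebesgue_measure K)).
  by rewrite fine_gt0// K_gt0 K_fin.
have /nbhs_ballP[e /= e0 eU] := compact_shift_sub _ _ _ cK oU KU.
exists e => // t; rewrite /= in_itv/= => te.
have {eU} tU x : K x -> U (x - t).
  by apply: eU; rewrite /ball/= sub0r normrN ltr_norml.
have [[x Kx Kxt]|disj] := pselect (exists2 x, K x & K (x + t)).
  by exists (x + t); [exact: KB|exists x; [exact: KB|rewrite addrC addKr]].
(* If no point of [K] were sent to [K] by translation by [t], the translate of
   [K] would lie in [U `\` K], which has smaller measure than [K]. *)
suff : (lebesgue_measure K <= lebesgue_measure (U `\` K))%E.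
  by rewrite leNgt -[X in (_ < X)%E]fineK// UK.
rewrite -(lebesgue_measure_preimage_addr _ t _ mK); apply: le_measure; rewrite ?inE.
- exact: measurable_preimage_addr.
- by apply: measurableD => //; exact: open_measurable.
- move=> x /= Kxt; split; last by move=> Kx; apply: disj; exists x.
  by rewrite -(addrK t x); exact: tU.
Qed.

(** The set [A] is [B] without its overlaps with countably many translates
    by numbers [t n] tending to zero: if [t n] is a difference [a - b] in
    [A], then [b] is in the [n]th deleted overlap. *)
Lemma lebesgue_null_small_difference_set (R : realType)
    (mu : {sigma_finite_measure set (measurableTypeR R) -> \bar R})
    (B : set (measurableTypeR R)) :
  measurable B -> lebesgue_measure B = 0%E ->
  exists A : set (measurableTypeR R), [/\ measurable A, mu A = mu B &
    forall e : R, 0 < e -> ~ `]- e, e[ `<=` difference_set A].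
Proof.
move=> mB B0.
pose overlap t : set (measurableTypeR R) := B `&` (+%R^~ t) @^-1` B.
have m_overlap t : measurable (overlap t).
  by apply: measurableI => //; exact: measurable_preimage_addr.
have /choice[t t_small] (n : nat) :
    exists t : R, [/\ 0 < t, t < n.+1%:R^-1 & mu (overlap t) = 0%E].
  by apply: ae_pos_small; [rewrite invr_gt0|exact: ae_null_overlap].
have mO : measurable (\bigcup_n overlap (t n)) by exact: bigcup_measurable.
have O0 : mu (\bigcup_n overlap (t n)) = 0%E.
  apply: measure_negligible => //; apply: negligible_bigcup => n.
  by apply/negligibleP => //; have [] := t_small n.
exists (B `\` \bigcup_n overlap (t n)); split.
- exact: measurableD.
- rewrite [RHS](measureDI mu mB mO)
    [X in (_ + X)%E](subset_measure0 _ _ _ O0) ?adde0//.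
  exact: measurableI.
- move=> e e0 sub.
  have [n ne] : exists n, n.+1%:R^-1 < e.
    by have [n] := ltr_add_invr e0; rewrite add0r; exists n.
  have [t0 tn _] := t_small n.
  have : `]- e, e[%classic (t n).
    by rewrite /= in_itv/= (lt_trans _ t0) ?oppr_lt0// (lt_trans tn).
  move=> /sub [a [Ba _] [b [Bb bO] ab]]; apply: bO; exists n => //.
  by split => //=; rewrite -ab addrC subrK.
Qed.

Theorem theorem1 (R : realType)
    (mu : {measure set (measurableTypeR R) -> \bar R})
    (mu_fin : finite_on_compacts mu) :
  steinhaus_property mu <-> content_dominates lebesgue_measure mu.
Proof.
have sf_mu : sigma_finite setT (Measure.sort mu).
  exact: finite_on_compacts_sigma_finite.
pose muS : {sigma_finite_measure set (measurableTypeR R) -> \bar R} :=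
  HB.pack (Measure.sort mu)
    (isSFinite.Build _ _ _ _ (sfinite_measure_sigma_finite sf_mu))
    (isSigmaFinite.Build _ _ _ _ sf_mu).
split=> [SP B mB B0|dom A].
  have [A [mA muAB noint]] := lebesgue_null_small_difference_set _ muS B mB B0.
  rewrite -[LHS](muAB : mu A = mu B).
  apply: contrapT => /eqP A_neq0.
  have [| |e e0 /noint] := SP A; last exact.
    by exists A => //; exists set0; [exact: negligible_set0|rewrite setU0].
  rewrite -[A]setU0 completed_measureU//; last exact: negligible_set0.
  by rewrite lt0e A_neq0 measure_ge0.
move=> [B mB [N nN <-]]; rewrite completed_measureU// => B_gt0.
have [|e e0 eB] := positive_lebesgue_difference_set _ B mB.
  rewrite lt0e measure_ge0 andbT; apply: contraTneq B_gt0 => B0.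
  by rewrite dom// ltxx.
exists e => // t /eB[a Ba [b Bb ab]].
by exists a; [left|exists b; [left|]].
Qed.
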